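(* Let $\Gamma \curvearrowright T$ be an action of a group $\Gamma$ by automorphisms on a simplicial tree $T$. Let $s$ be an oriented geodesic segment in $T$, and let $f_s$ be the corresponding median quasimorphism of $\Gamma \curvearrowright T$. Then, for every $n \geq 1$ and every $\zeta \in H^n_{\Gamma,b}(T;\mathbb{R})$, the cup product $[\delta^1 f_s] \cup \zeta$ is trivial in $H^{n+2}_{\Gamma,b}(T;\mathbb{R})$.
   Context: Equivariant bounded cohomology: for an action of a (discrete) group $\Gamma$ on a set $S$, let $C^n_{\Gamma,b}(S;\mathbb{R}) := \ell^\infty(S^{n+1},\mathbb{R})^\Gamma$ be the space of bounded functions $S^{n+1}\to\mathbb{R}$ that are invariant under the diagonal $\Gamma$-action, with simplicial coboundary $\delta^n\kappa(x_0,\dots,x_{n+1})=\sum_{j=0}^{n+1}(-1)^j\kappa(x_0,\dots,\hat x_j,\dots,x_{n+1})$. Then $H^*_{\Gamma,b}(S;\mathbb{R})$ is the cohomology of this complex. The cup product is induced by $(f\cup g)(x_0,\dots,x_{p+q})=f(x_0,\dots,x_p)\cdot g(x_p,\dots,x_{p+q})$. For a tree $T$ with vertex set $V$, $H^*_{\Gamma,b}(T;\mathbb{R}):=H^*_{\Gamma,b}(V;\mathbb{R})$. An oriented geodesic segment in $T$ is a finite oriented geodesic edge path (of length $l\ge 1$). $\Gamma$ acts on oriented segments, and the elements of the orbit $\Gamma s$ are called translates of $s$. For $x,y\in V$, $[x,y]$ denotes the oriented geodesic from $x$ to $y$. The median quasimorphism $f_s\colon V\times V\to\mathbb{R}$ is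 defined by letting $f_s(x,y)$ be the number of translates of $s$ that occur as (oriented) subsegments of $[x,y]$ minus the number of translates of $s$ that occur as (oriented) subsegments of $[y,x]$. The function $f_s$ is $\Gamma$-invariant and $\delta^1 f_s$ is bounded, so $\delta^1 f_s$ is a bounded cocycle and defines a class $[\delta^1 f_s]\in H^2_{\Gamma,b}(T;\mathbb{R})$. *)

(* Defs.v *)
From HB Require Import structures.
From mathcomp Require Import all_boot all_order all_algebra.
From mathcomp Require Import finmap.
From mathcomp Require Import all_classical reals topology normedtype.
From mathcomp Require Import zify ring lra.

Set Implicit Arguments.
Unset Strict Implicit.
Unset Printing Implicit Defensive.

Import Order.TTheory GRing.Theory Num.Theory.
Import numFieldNormedType.Exports.

Local Open Scope classical_set_scope.
Local Open Scope ring_scope.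

Record action (Gamma : groupType) (S : Type) := Action {
  act :> Gamma -> S -> S;
  act1 : forall x, act 1%g x = x;
  actM : forall g h x, act (g * h)%g x = act g (act h x)
}.

Notation cochain R S n := (('I_n.+1 -> S) -> R).

(* [x \o lift j] is the tuple [x] with its [j]-th entry removed. *)
Definition coboundary (R : realType) (S : Type) (n : nat)
    (k : cochain R S n) : cochain R S n.+1 :=
  fun x => \sum_(j < n.+2) (-1) ^+ j * k (x \o lift j).

(* The entry [p] is shared: it is the last argument of [f] and the first one
   of [g]. The type ['I_(p.+1 + q)] of [lshift q i] is convertible to
   ['I_(p + q).+1], whereas [rshift p i] has to be cast. *)
Definition cup_cochain (R : realType) (S : Type) (p q : nat)
    (f : cochain R S p) (g : cochain R S q) : cochain R S (p + q) :=
  fun x => f (fun i : 'I_p.+1 => x (lshift q i))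
         * g (fun i : 'I_q.+1 => x (cast_ord (addnS p q) (rshift p i))).

Section NatIndexed.
Variables (R : realType) (S : Type).

(* Cochains evaluated on sequences indexed by [nat]: this avoids all casts
   between ordinals in the proofs below. *)
Definition ev n (k : cochain R S n) (X : nat -> S) : R :=
  k (fun i : 'I_n.+1 => X i).

Lemma evE n (k : cochain R S n) (x : 'I_n.+1 -> S) :
  k x = ev k (fun j => x (inord j)).
Proof. by rewrite /ev; congr (k _); apply/funext => i; rewrite inord_val. Qed.

Lemma ev_inj n (k l : cochain R S n) : (forall X, ev k X = ev l X) -> k = l.
Proof. by move=> kl; apply/funext => x; rewrite !evE kl. Qed.

Lemma ev_coboundary n (k : cochain R S n) X :
  ev (coboundary k) X = \sum_(j < n.+2) (-1) ^+ j * ev k (X \o bump j).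
Proof. by []. Qed.

Lemma ev_cup p q (f : cochain R S p) (g : cochain R S q) X :
  ev (cup_cochain f g) X = ev f X * ev g (fun i => X (p + i)%N).
Proof. by []. Qed.

Lemma ev_eq n (k : cochain R S n) X Y :
  (forall i, (i <= n)%N -> X i = Y i) -> ev k X = ev k Y.
Proof.
by move=> XY; rewrite /ev; congr (k _); apply/funext => i; rewrite XY// -ltnS.
Qed.

Lemma coboundaryB n (k l : cochain R S n) :
  coboundary (k - l) = coboundary k - coboundary l.
Proof.
apply/funext => x; rewrite /coboundary /= -[RHS]/(_ - _) -sumrB.
by apply: eq_bigr => j _; rewrite -mulrBr.
Qed.

Lemma coboundary0 n : coboundary (0 : cochain R S n) = 0.
Proof. by rewrite -[X in coboundary X](subrr 0) coboundaryB subrr. Qed.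

Lemma coboundaryZ n c (k : cochain R S n) :
  coboundary (fun x => c * k x) = fun x => c * coboundary k x.
Proof.
apply/funext => x; rewrite /coboundary mulr_sumr.
by apply: eq_bigr => j _; rewrite mulrCA.
Qed.

Lemma alternating_sum0 N (F : nat -> nat -> R) :
  (forall i j, (j <= i)%N -> F i.+1 j = F j i) ->
  \sum_(i < N.+1) \sum_(j < N) (-1) ^+ (i + j) * F i j = 0.
Proof.
move=> FE.
have split_sum (i : 'I_N.+1) : \sum_(j < N) (-1) ^+ (i + j) * F i j =
    \sum_(j < N | (j < i)%N) (-1) ^+ (i + j) * F i j +
    \sum_(j < N | (i <= j)%N) (-1) ^+ (i + j) * F i j.
  rewrite (bigID (fun j : 'I_N => (j < i)%N)) /=; congr (_ + _).
  by apply: eq_bigl => j; rewrite -leqNgt.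
under eq_bigr do rewrite split_sum.
rewrite big_split /= big_ord_recl /= big_pred0 ?add0r//.
rewrite [X in _ + X]big_ord_recr /= [X in _ + (_ + X)]big_pred0 ?addr0; last first.
  by move=> j; rewrite leqNgt ltn_ord.
rewrite [X in _ + X](eq_bigr (fun i : 'I_N => \sum_(j < N | (i <= j)%N)
   (-1) ^+ (i + j) * F i j))//.
rewrite [X in _ + X](exchange_big_dep xpredT)//=.
rewrite -big_split /= big1// => i _.
rewrite -big_split_idem /= ?addr0// big1 // => j ji.
by rewrite /bump leq0n add1n FE// addSn exprS mulN1r mulNr addnC addNr.
Qed.

Lemma coboundaryK n (k : cochain R S n) : coboundary (coboundary k) = 0.
Proof.
apply: ev_inj => X; rewrite ev_coboundary.
under eq_bigr do rewrite ev_coboundary mulr_sumr.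
rewrite -[RHS](@alternating_sum0 n.+2
  (fun i j => ev k (X \o bump i \o bump j))); last first.
  by move=> i j ji; apply: ev_eq => u _ /=; congr (X _); rewrite /bump; lia.
by apply: eq_bigr => i _; apply: eq_bigr => j _; rewrite mulrA -exprD.
Qed.

Lemma ev_leibniz p q (f : cochain R S p) (g : cochain R S q) X :
  ev (coboundary (cup_cochain f g)) X =
    ev (coboundary f) X * ev g (fun i => X (p.+1 + i)%N)
  + (-1) ^+ p * (ev f X * ev (coboundary g) (fun i => X (p + i)%N)).
Proof.
rewrite !ev_coboundary.
rewrite -(big_mkord xpredT
  (fun j => (-1) ^+ j * ev (cup_cochain f g) (X \o bump j))).
rewrite (@big_cat_nat _ _ _ p.+1)//=; last by lia.
rewrite [in RHS]big_ord_recr /= [in X in _ = _ + X]big_ord_recl /= mulrDl.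
rewrite mulrDr mulrDr -!addrA; congr (_ + _).
  rewrite big_mkord mulr_suml; apply: eq_bigr => j _.
  rewrite ev_cup !mulrA; congr (_ * _).
  by apply: ev_eq => i _ /=; congr (X _); move: (ltn_ord j); rewrite /bump; lia.
rewrite addrA.
have -> : (-1) ^+ p.+1 * ev f (X \o bump p.+1) * ev g (fun i => X (p.+1 + i)%N)
   + (-1) ^+ p * (ev f X * ((-1) ^+ 0 *
        ev g ((fun i => X (p + i)%N) \o bump 0))) = 0.
  rewrite exprS expr0 mul1r mulN1r !mulNr addrC; apply/eqP; rewrite subr_eq0.
  rewrite mulrA; apply/eqP; congr (_ * _ * _).
    by apply: ev_eq => i ip /=; congr (X _); rewrite /bump; lia.
  by apply: ev_eq => i ip /=; congr (X _); rewrite /bump; lia.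
rewrite add0r -{1}[p.+1]add0n big_addn (_ : (p + q).+2 - p.+1 = q.+1)%N; last lia.
rewrite big_mkord !mulr_sumr; apply: eq_bigr => j _.
rewrite ev_cup /bump /= !mulrA -[X in _ = X * _]mulrAC -exprD add1n.
rewrite (_ : j + p.+1 = p + j.+1)%N; last lia.
rewrite -!mulrA; congr (_ * (_ * _)).
  by apply: ev_eq => i ip /=; congr (X _); lia.
by apply: ev_eq => i ip /=; congr (X _); lia.
Qed.

End NatIndexed.

(* [bounded_fun f] is the usual sup-norm boundedness, see [bounded_funE]. *)
Definition bounded_cochain (R : realType) (Gamma : groupType) (S : Type)
    (a : action Gamma S) (n : nat) : set (cochain R S n) :=
  [set f | bounded_fun f /\
           forall (g : Gamma) (x : 'I_n.+1 -> S), f (a g \o x) = f x].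
Arguments bounded_cochain {R Gamma S} a n _.

Definition bounded_coboundary (R : realType) (Gamma : groupType) (S : Type)
    (a : action Gamma S) (n : nat) : set (cochain R S n) :=
  match n with
  | 0 => [set 0]
  | m.+1 => @coboundary R S m @` bounded_cochain a m
  end.
Arguments bounded_coboundary {R Gamma S} a n _.

Definition bcocycle (R : realType) (Gamma : groupType) (S : Type)
    (a : action Gamma S) (n : nat) : {pred cochain R S n} :=
  mem [set f | bounded_cochain a n f /\ coboundary f = 0].
Arguments bcocycle R {Gamma S} a n.

Section CochainTheory.
Variables (R : realType) (Gamma : groupType) (S : Type) (a : action Gamma S).

Lemma bounded_funE (U : Type) (f : U -> R) :
  bounded_fun f <-> exists M, forall x, `|f x| <= M.
Proof.
split=> [|[M fM]]; last first.
  exists M; split; first exact: num_real.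
  by move=> N MN x _ /=; apply: le_trans (fM x) (ltW MN).
move=> [M [_ fM]]; exists (M + 1) => x.
by apply: (fM (M + 1)) => //; rewrite ltrDl.
Qed.

Lemma bounded_cochain0 n : bounded_cochain a n (0 : cochain R S n).
Proof.
by split=> //; apply/bounded_funE; exists 0 => x; rewrite normr0.
Qed.

Lemma bounded_cochainB n (f g : cochain R S n) :
  bounded_cochain a n f -> bounded_cochain a n g -> bounded_cochain a n (f - g).
Proof.
move=> [/bounded_funE[M fM] fa] [/bounded_funE[N gN] ga]; split.
  apply/bounded_funE; exists (M + N) => x /=.
  by apply: le_trans (ler_normB _ _) _; apply: lerD.
by move=> h x; rewrite -[LHS]/(_ - _) fa ga.
Qed.

Lemma bounded_cochainZ n c (f : cochain R S n) :
  bounded_cochain a n f -> bounded_cochain a n (fun x => c * f x).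
Proof.
move=> [/bounded_funE[M fM] fa]; split; last by move=> h x; rewrite fa.
apply/bounded_funE; exists (`|c| * M) => x.
by rewrite normrM ler_wpM2l.
Qed.

Lemma bounded_cochain_cup p q (f : cochain R S p) (g : cochain R S q) :
  bounded_cochain a p f -> bounded_cochain a q g ->
  bounded_cochain a (p + q) (cup_cochain f g).
Proof.
move=> [/bounded_funE[M fM] fa] [/bounded_funE[N gN] ga]; split.
  apply/bounded_funE; exists (M * N) => x.
  by rewrite normrM; apply: ler_pM.
by move=> h x; congr (_ * _); [exact: fa|exact: ga].
Qed.

Lemma coboundary_invariant n (f : cochain R S n) :
  (forall (h : Gamma) x, f (a h \o x) = f x) ->
  forall (h : Gamma) x, coboundary f (a h \o x) = coboundary f x.
Proof. by move=> fa h x; apply: eq_bigr => j _; congr (_ * _); exact: fa. Qed.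

Lemma bounded_cochain_coboundary n (f : cochain R S n) :
  bounded_cochain a n f -> bounded_cochain a n.+1 (coboundary f).
Proof.
move=> [/bounded_funE[M fM] fa]; split; last exact: coboundary_invariant.
apply/bounded_funE; exists (\sum_(j < n.+2) M) => x.
apply: le_trans (ler_norm_sum _ _ _) _; apply: ler_sum => j _.
by rewrite normrMsign.
Qed.

Lemma bounded_coboundaryB n (f g : cochain R S n) :
  bounded_coboundary a n f -> bounded_coboundary a n g ->
  bounded_coboundary a n (f - g).
Proof.
case: n f g => [|n] f g /=; first by move=> -> ->; rewrite subrr.
move=> [k kb <-] [l lb <-]; exists (k - l); first exact: bounded_cochainB.
exact: coboundaryB.
Qed.

Lemma bounded_coboundary0 n : bounded_coboundary a n (0 : cochain R S n).
Proof.
case: n => //= n; exists 0; last exact: coboundary0.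
exact: bounded_cochain0.
Qed.

Lemma bcocycleP n (f : cochain R S n) :
  reflect (bounded_cochain a n f /\ coboundary f = 0) (f \in bcocycle R a n).
Proof. by apply: (iffP idP); rewrite inE. Qed.

Fact bcocycle_zmod_closed n : zmod_closed (bcocycle R a n).
Proof.
split=> [|f g /bcocycleP[fb f0] /bcocycleP[gb g0]]; apply/bcocycleP; split.
- exact: bounded_cochain0.
- exact: coboundary0.
- exact: bounded_cochainB.
- by rewrite coboundaryB f0 g0 subrr.
Qed.

HB.instance Definition _ n :=
  GRing.isZmodClosed.Build (cochain R S n) (bcocycle R a n)
    (bcocycle_zmod_closed n).

Lemma cup_bcocycle p q (f : cochain R S p) (g : cochain R S q) :
  f \in bcocycle R a p -> g \in bcocycle R a q ->
  cup_cochain f g \in bcocycle R a (p + q).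
Proof.
move=> /bcocycleP[fb f0] /bcocycleP[gb g0]; apply/bcocycleP; split.
  exact: bounded_cochain_cup.
apply: ev_inj => X; rewrite ev_leibniz f0 g0 /ev.
by rewrite -![(0 : _ -> _) _]/0 mul0r mulr0 mulr0 addr0.
Qed.

(* The coboundary of a possibly unbounded cochain. *)
Lemma coboundary_bcocycle n (f : cochain R S n) :
  (forall (h : Gamma) x, f (a h \o x) = f x) -> bounded_fun (coboundary f) ->
  coboundary f \in bcocycle R a n.+1.
Proof.
move=> fa fb; apply/bcocycleP; split; last exact: coboundaryK.
by split=> //; apply: coboundary_invariant.
Qed.

End CochainTheory.

Record Zb (R : realType) (Gamma : groupType) (S : Type) (a : action Gamma S)
    (n : nat) := MkZb {
  Zb_val :> cochain R S n;
  Zb_valP : Zb_val \in bcocycle R a n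
}.
Arguments Zb R {Gamma S} a n.

HB.instance Definition _ (R : realType) (Gamma : groupType) (S : Type)
  (a : action Gamma S) (n : nat) := [isSub of Zb R a n for @Zb_val R Gamma S a n].
HB.instance Definition _ (R : realType) (Gamma : groupType) (S : Type)
  (a : action Gamma S) (n : nat) := [Choice of Zb R a n by <:].
HB.instance Definition _ (R : realType) (Gamma : groupType) (S : Type)
  (a : action Gamma S) (n : nat) := [SubChoice_isSubZmodule of Zb R a n by <:].

Definition Bb (R : realType) (Gamma : groupType) (S : Type) (a : action Gamma S)
    (n : nat) : {pred Zb R a n} :=
  mem [set z : Zb R a n | bounded_coboundary a n z].
Arguments Bb R {Gamma S} a n.

Fact Bb_zmod_closed (R : realType) (Gamma : groupType) (S : Type)
  (a : action Gamma S) (n : nat) : zmod_closed (Bb R a n).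
Proof.
split=> [|u v]; rewrite !inE /=; first exact: bounded_coboundary0.
exact: bounded_coboundaryB.
Qed.

HB.instance Definition _ (R : realType) (Gamma : groupType) (S : Type)
    (a : action Gamma S) (n : nat) :=
  GRing.isZmodClosed.Build (Zb R a n) (Bb R a n) (Bb_zmod_closed R a n).

Definition Hb (R : realType) (Gamma : groupType) (S : Type) (a : action Gamma S)
    (n : nat) : zmodType := {ideal_quot Bb R a n}.
Arguments Hb R {Gamma S} a n.

Definition Hb_class (R : realType) (Gamma : groupType) (S : Type)
    (a : action Gamma S) (n : nat) (z : Zb R a n) : Hb R a n :=
  \pi_({ideal_quot Bb R a n})%qT z.

Definition cupZ (R : realType) (Gamma : groupType) (S : Type)
    (a : action Gamma S) (p q : nat) (u : Zb R a p) (v : Zb R a q) :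
    Zb R a (p + q) :=
  MkZb (cup_bcocycle (Zb_valP u) (Zb_valP v)).

(* Independence of the representatives chosen by [repr] is [cup_class]. *)
Definition cup (R : realType) (Gamma : groupType) (S : Type)
    (a : action Gamma S) (p q : nat) (u : Hb R a p) (v : Hb R a q) :
    Hb R a (p + q) :=
  Hb_class (cupZ (repr (u : {ideal_quot Bb R a p})) (repr (v : {ideal_quot Bb R a q}))).

Section CupTheory.
Variables (R : realType) (Gamma : groupType) (S : Type) (a : action Gamma S).

Lemma Hb_classP n (u v : Zb R a n) :
  Hb_class u = Hb_class v <-> bounded_coboundary a n (u - v : cochain R S n).
Proof.
have E : ((u - v) \in Bb R a n) =
    (bounded_coboundary a n (u - v : cochain R S n) : Prop) :> Prop.
  by rewrite inE.
rewrite -E /Hb_class; split=> [/eqP|uv]; first by rewrite -Quotient.idealrBE.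
by apply/eqP; rewrite -Quotient.idealrBE.
Qed.

Lemma Hb_class_eq0 n (u : Zb R a n) :
  Hb_class u = 0 <-> bounded_coboundary a n (u : cochain R S n).
Proof.
have -> : 0 = Hb_class (0 : Zb R a n) by rewrite /Hb_class; apply/esym/pi_zeror.
by rewrite Hb_classP subr0.
Qed.

Lemma cup_cochainBl p q (f f' : cochain R S p) (g : cochain R S q) :
  cup_cochain (f - f') g = cup_cochain f g - cup_cochain f' g.
Proof. by apply/funext => x; rewrite /cup_cochain mulrBl. Qed.

Lemma cup_cochainBr p q (f : cochain R S p) (g g' : cochain R S q) :
  cup_cochain f (g - g') = cup_cochain f g - cup_cochain f g'.
Proof. by apply/funext => x; rewrite /cup_cochain mulrBr. Qed.

Lemma bounded_coboundary_cupl p q (f : cochain R S p) (g : cochain R S q) :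
  bounded_coboundary a p f -> g \in bcocycle R a q ->
  bounded_coboundary a (p + q) (cup_cochain f g).
Proof.
case: p f => [|p] f /= fb /bcocycleP[gb g0].
  rewrite fb (_ : cup_cochain _ _ = 0); first exact: bounded_coboundary0.
  by apply/funext => x; rewrite /cup_cochain mul0r.
case: fb => k kb <-; exists (cup_cochain k g).
  exact: bounded_cochain_cup.
apply: ev_inj => X; rewrite ev_leibniz g0 [ev 0 _]/ev.
by rewrite -[(0 : _ -> _) _]/0 !mulr0 addr0.
Qed.

Lemma bounded_coboundary_cupr p q (f : cochain R S p) (g : cochain R S q) :
  f \in bcocycle R a p -> bounded_coboundary a q g ->
  bounded_coboundary a (p + q) (cup_cochain f g).
Proof.
move=> /bcocycleP[fb f0]; case: q g => [|q] g /= gb.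
  rewrite gb (_ : cup_cochain _ _ = 0); first exact: bounded_coboundary0.
  by apply/funext => x; rewrite /cup_cochain mulr0.
case: gb => k kb <-.
pose l : cochain R S (p + q) := fun x => (-1) ^+ p * cup_cochain f k x.
have lb : bounded_cochain a (p + q) l.
  exact/bounded_cochainZ/bounded_cochain_cup.
suff E X : ev (cup_cochain f (coboundary k)) X = ev (coboundary l) X.
  move: (cup_cochain _ _) E; rewrite addnS => h E; exists l => //.
  by apply: ev_inj => X; rewrite E.
rewrite coboundaryZ.
rewrite -[RHS]/((-1) ^+ p * ev (coboundary (cup_cochain f k)) X) ev_leibniz f0.
by rewrite [ev 0 _]/ev -[(0 : _ -> _) _]/0 mul0r add0r mulrA -expr2 sqrr_sign mul1r.
Qed.

Lemma cup_class p q (u : Zb R a p) (v : Zb R a q) :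
  cup (Hb_class u) (Hb_class v) = Hb_class (cupZ u v).
Proof.
rewrite /cup; set u' := repr _; set v' := repr _.
have uu' : bounded_coboundary a p (u' - u : cochain R S p).
  by apply/Hb_classP; rewrite /Hb_class reprK.
have vv' : bounded_coboundary a q (v' - v : cochain R S q).
  by apply/Hb_classP; rewrite /Hb_class reprK.
apply/Hb_classP.
have -> : (cupZ u' v' - cupZ u v : cochain R S (p + q)) =
    cup_cochain (u' - u : cochain R S p) v' -
    cup_cochain u (v - v' : cochain R S q).
  rewrite cup_cochainBl cup_cochainBr /=.
  by apply/funext => x; rewrite !fctE; ring.
apply: bounded_coboundaryB.
  by apply: bounded_coboundary_cupl => //; apply: Zb_valP.
apply: bounded_coboundary_cupr; first exact: Zb_valP.
rewrite -[X in bounded_coboundary _ _ X](opprB (v' : cochain R S q)) -sub0r.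
by apply: bounded_coboundaryB => //; apply: bounded_coboundary0.
Qed.

End CupTheory.

(* Classically every type is a [choiceType] and every relation is boolean.
   In [adj_acyclic], a cycle of size 2 just follows an edge back and forth.
   Segments below provide a vertex, so nonemptiness is not required. *)
Record tree := Tree {
  vertex :> choiceType;
  adj : rel vertex;
  adj_sym : symmetric adj;
  adj_irr : irreflexive adj;
  adj_connected : forall x y, exists2 p, path adj x p & last x p = y;
  adj_acyclic : forall c : seq vertex, ucycle adj c -> (size c <= 2)%N
}.

(* The edge path [x :: p] is geodesic if no edge path with the same end points
   is shorter; its length is [size p]. *)
Definition geodesic (T : tree) (x : T) (p : seq T) : Prop :=
  path (@adj T) x p /\
  forall q, path (@adj T) x q -> last x q = last x p -> (size p <= size q)%N.

Record segment (T : tree) := Segment {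
  seg_start : T;
  seg_rest : seq T;
  seg_geodesic : geodesic seg_start seg_rest;
  seg_length : (0 < size seg_rest)%N
}.

Definition seg_vertices (T : tree) (s : segment T) : seq T :=
  seg_start s :: seg_rest s.

Record tree_action (Gamma : groupType) (T : tree) := TreeAction {
  tree_act :> action Gamma T;
  tree_act_adj : forall g x y, adj (tree_act g x) (tree_act g y) = adj x y
}.

Section TreeTheory.
Variable T : tree.
Notation adj := (@adj T).

Lemma geodesic_exists (x y : T) : exists p, geodesic x p /\ last x p = y.
Proof.
have [p0 p0P p0y] := adj_connected x y.
have ex : exists n, `[< exists p, [/\ path adj x p, last x p = y & size p = n] >].
  by exists (size p0); apply/asboolP; exists p0.
case: (ex_minnP ex) => n /asboolP[p [pP py pn]] nmin.
exists p; split=> //; split=> // q qP qp; rewrite pn; apply: nmin.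
by apply/asboolP; exists q; rewrite qp.
Qed.

End TreeTheory.

(* The geodesic [x, y], as the list of its vertices. *)
Definition geod (T : tree) (x y : T) : seq T :=
  x :: sval (cid (geodesic_exists x y)).

Section TreeTheory.
Variable T : tree.
Notation adj := (@adj T).
Implicit Types (x y z : T) (p q w : seq T).

Lemma has_split (P : pred T) w : has P w ->
  exists w1 m w2, [/\ w = w1 ++ m :: w2, P m & ~~ has P w1].
Proof. by case/split_find=> m w1 w2; rewrite cat_rcons; exists w1, m, w2. Qed.

Lemma mem_split m w : m \in w -> exists w1 w2, w = w1 ++ m :: w2.
Proof. by case/splitPr=> w1 w2; exists w1, w2. Qed.

Lemma path_rev x p y : path adj x (rcons p y) = path adj y (rcons (rev p) x).
Proof.
have := rev_path adj x (rcons p y).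
rewrite last_rcons belast_rcons rev_cons => ->.
by apply: eq_path => u v; rewrite adj_sym.
Qed.

Lemma uniq_path_unique x p q :
  path adj x p -> uniq (x :: p) -> path adj x q -> uniq (x :: q) ->
  last x p = last x q -> p = q.
Proof.
elim: p x q => [|a p IH] x [|b q] //.
- move=> _ _ _ /andP[xq _] E; exfalso; move/negP: xq; apply.
  by rewrite [X in X \in _](E : x = last b q) mem_last.
- move=> _ /andP[xp _] _ _ E; exfalso; move/negP: xp; apply.
  by rewrite -[X in X \in _](E : last a p = x) mem_last.
case: (eqVneq a b) => [<-|ab].
  move=> /andP[_ pP] /andP[_ pU] /andP[_ qP] /andP[_ qU] E.
  by rewrite (IH a q).
set P := a :: p; set Q := b :: q => PP /andP[xP PU] QP /andP[xQ QU] E.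
exfalso; have {}PU : uniq P := PU; have {}QU : uniq Q := QU.
have PQ : has (mem Q) P.
  apply/hasP; exists (last a p); first exact: mem_last.
  by rewrite /= (E : last a p = last b q) mem_last.
have abne : ~~ ((ohead P == ohead Q)) by rewrite /=; apply: contra ab => /eqP[->].
move: (has_split PQ) => [p1 [c [p2 [PE cQ p1Q]]]].
move: (mem_split cQ) => [q1 [q2 QE]].
move: PP PU xP QP QU xQ p1Q abne; rewrite PE QE -cat_rcons.
move=> PP PU xP QP QU xQ p1Q abne.
pose C := x :: rcons p1 c ++ rev q1.
suff /adj_acyclic : ucycle adj C.
  rewrite /C /= size_cat size_rcons size_rev addSn !ltnS leqn0 addn_eq0.
  move: abne; rewrite -cats1 -catA; case: (p1) (q1) => [|? ?] [|? ?] //=.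
  by rewrite eqxx.
apply/andP; split.
- rewrite /C /= rcons_cat cat_path last_rcons -path_rev.
  move: PP QP; rewrite !cat_path => /andP[-> _] /=.
  by rewrite rcons_path => /and3P[-> -> _].
- rewrite /C /= mem_cat mem_rev negb_or cat_uniq rev_uniq.
  move: xP xQ PU QU; rewrite !mem_cat !negb_or !cat_uniq => /andP[-> _].
  move=> /andP[-> _] /andP[-> _] /and3P[-> cq1 _]; rewrite andbT /=.
  rewrite andbT; apply/hasPn => u; rewrite mem_rev => uq1; rewrite mem_rcons inE negb_or.
  apply/andP; split.
    apply: contra cq1 => /eqP <-; apply/hasP; exists u => //.
    by rewrite mem_head.
  apply: contra p1Q => up1; apply/hasP; exists u => //.
  by rewrite /= mem_cat uq1.
Qed.

Lemma geodesicP x p : geodesic x p <-> path adj x p /\ uniq (x :: p).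
Proof.
split=> [[pP pmin]|[pP pU]]; split=> //.
- case: (shortenP pP) (pmin (shorten x p)) => p' p'P p'U p'p pmin'.
  apply: (leq_size_uniq p'U); last by rewrite /= ltnS pmin'.
  by move=> u; rewrite !inE => /orP[->//|/p'p ->]; rewrite orbT.
move=> q qP; case: (shortenP qP) => q' q'P q'U q'q E.
rewrite (uniq_path_unique pP pU q'P q'U (esym E)).
by apply: uniq_leq_size => //; case/andP: q'U.
Qed.

(* Vertex lists of geodesic segments, of any length. *)
Definition simple w := sorted adj w && uniq w.

Lemma geodE x p : simple (x :: p) -> geod x (last x p) = x :: p.
Proof.
move=> /andP[pP pU]; rewrite /geod; case: cid => q /= [/geodesicP[qP qU] qp].
by rewrite (uniq_path_unique qP qU pP pU).
Qed.

Lemma geodP x y : exists2 p, geod x y = x :: p & simple (x :: p) /\ last x p = y.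
Proof.
rewrite /geod; case: cid => q /= [/geodesicP[qP qU] qp]; exists q => //.
by split=> //; apply/andP.
Qed.

Lemma sorted_rev w : sorted adj (rev w) = sorted adj w.
Proof.
rewrite rev_sorted; case: w => //= x p.
by apply: eq_path => u v; rewrite adj_sym.
Qed.

Lemma uniq_catI (w1 w2 : seq T) : uniq w1 -> uniq w2 ->
  (forall u, u \in w2 -> u \notin w1) -> uniq (w1 ++ w2).
Proof.
by move=> u1 u2 u12; rewrite cat_uniq u1 u2 andbT; apply/hasPn.
Qed.

Lemma simple_rev w : simple (rev w) = simple w.
Proof.
by rewrite /simple rev_uniq sorted_rev.
Qed.

Lemma sorted_cat_cons w m p :
  sorted adj (w ++ m :: p) = sorted adj (rcons w m) && path adj m p.
Proof. by case: w => //= x w; rewrite cat_path rcons_path andbA. Qed.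

Lemma geod_rev A m B x y : simple (rev A ++ m :: B) ->
  x = last m A -> y = last m B -> geod x y = rev A ++ m :: B.
Proof.
move=> AB -> ->; case/lastP: A AB => [|A a]; first exact: geodE.
rewrite rev_rcons last_rcons /= => AB.
by rewrite -(geodE AB) last_cat /=.
Qed.

Lemma median_exists x y z : exists m A B C,
  [/\ [/\ last m A = x, last m B = y & last m C = z],
      simple (rev A ++ m :: B), simple (rev B ++ m :: C)
    & simple (rev A ++ m :: C)].
Proof.
have [p _ [pS py]] := geodP x y; have [q _ [qS qx]] := geodP z x.
have hasq : has (mem (x :: p)) (z :: q).
  by apply/hasP; exists x; rewrite /= ?mem_head// -qx mem_last.
have [Q1 [m [Q2 [QE mP Q1P]]]] := has_split hasq.
have [P1 [P2 PE]] := mem_split mP.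
have zE : head x (Q1 ++ m :: Q2) = z by rewrite -QE.
have xE : head x (P1 ++ m :: P2) = x by rewrite -PE.
have yE : last x (P1 ++ m :: P2) = y by rewrite -PE.
move: Q1P pS qS; rewrite PE QE => Q1P PS QS.
exists m, (rev P1), P2, (rev Q1); rewrite !revK.
have [sP uP] := andP PS; have [sQ uQ] := andP QS.
have QP1 u : u \in Q1 -> u \notin P1 ++ m :: P2.
  by move=> uQ1; apply: contra Q1P => uP1; apply/hasP; exists u.
move: sP sQ; rewrite !sorted_cat_cons => /andP[sP1 sP2] /andP[sQ1 _].
move: uP uQ; rewrite !cat_uniq /= !negb_or.
move=> /and3P[uP1 /andP[mP1 hP] /andP[mP2 uP2]] /and3P[uQ1 /andP[mQ1 _] _].
have notQ1 u : u \in P1 ++ m :: P2 -> u \notin Q1.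
  by move=> uP; apply: contraL uP; apply: QP1.
have S1 : simple (Q1 ++ m :: P2).
  rewrite /simple sorted_cat_cons sQ1 sP2; apply: uniq_catI => //=.
    by rewrite mP2.
  by move=> u uP2'; apply: notQ1; rewrite mem_cat uP2' orbT.
have S2 : simple (Q1 ++ m :: rev P1).
  rewrite /simple sorted_cat_cons sQ1.
  rewrite -[path adj m _]/(sorted adj (m :: rev P1)) -rev_rcons sorted_rev sP1.
  rewrite rev_rcons; apply: uniq_catI => //=; first by rewrite mem_rev mP1 rev_uniq.
  move=> u; rewrite inE mem_rev => uP1'; apply: notQ1; rewrite mem_cat inE.
  by case/orP: uP1' => ->; rewrite ?orbT.
split=> //.
- split.
  + by move: xE; case: (P1) => // u P1' /= <-; rewrite rev_cons last_rcons.
  + by rewrite -yE last_cat.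
  + by move: zE; case: (Q1) => // u Q1' /= <-; rewrite rev_cons last_rcons.
- by rewrite -simple_rev rev_cat rev_cons ?revK cat_rcons.
- by rewrite -simple_rev rev_cat rev_cons ?revK cat_rcons.
Qed.

End TreeTheory.

Definition translates (Gamma : groupType) (T : tree) (a : tree_action Gamma T)
    (s : segment T) : set (seq T) :=
  [set map (a g) (seg_vertices s) | g in [set: Gamma]].

(* The set is finite ([translatesE]), so [fset_set] is not its junk value. *)
Definition ntranslates (Gamma : groupType) (T : tree) (a : tree_action Gamma T)
    (s : segment T) (x y : T) : nat :=
  #|` fset_set (translates a s `&` [set t | infix t (geod x y)])|%fset.

Definition median_qm (R : realType) (Gamma : groupType) (T : tree)
    (a : tree_action Gamma T) (s : segment T) (x y : T) : R :=
  (ntranslates a s x y)%:R - (ntranslates a s y x)%:R.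

Definition median_cochain (R : realType) (Gamma : groupType) (T : tree)
    (a : tree_action Gamma T) (s : segment T) : cochain R T 1 :=
  fun x => median_qm R a s (x ord0) (x ord_max).

Section MedianTheory.
Variables (R : realType) (Gamma : groupType) (T : tree).
Variables (a : tree_action Gamma T) (s : segment T).
Notation adj := (@adj T).
Implicit Types (x y z m : T) (t w A B C : seq T).

Let k := size (seg_vertices s).
Let tr t := `[< translates a s t >].

Fixpoint occurrences w : nat :=
  if w is _ :: w' then (tr (take k w) + occurrences w')%N else 0%N.

Lemma tr_size t : tr t -> size t = k.
Proof. by move/asboolP => [g _ <-]; rewrite size_map. Qed.

Lemma translatesE w : uniq w ->
  exists2 F : {fset seq T}, translates a s `&` [set t | infix t w] = [set` F]
    & #|` F|%fset = occurrences w.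
Proof.
elim: w => [_|x w IH /andP[xw wU]].
  exists fset0; last by rewrite cardfs0.
  apply/seteqP; split=> t //= [/asboolP/tr_size tk].
  by move=> /eqP tE; move: tk; rewrite tE.
have [F FE Fw] := IH wU.
have FP t : t \in F <-> translates a s t /\ infix t w.
  by rewrite -[_ /\ _]/((translates a s `&` [set t | infix t w]) t) FE.
have SP t : (translates a s `&` [set t | infix t (x :: w)]) t <->
    translates a s t /\ (t = take k (x :: w) \/ infix t w).
  split=> -[tt]; have /tr_size tk : tr t by apply/asboolP.
    rewrite /mkset infix_consl prefixE tk => /orP[/eqP tE|tw]; split=> //.
      by left; rewrite tE.
    by right.
  move=> tw; split=> //; rewrite /mkset infix_consl prefixE tk.
  by case: tw => [<-|->]; rewrite ?eqxx ?orbT.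
rewrite [occurrences _]/= -Fw -/(take k (x :: w)).
case: (boolP (tr (take k (x :: w)))) => [trx|ntrx].
  exists (take k (x :: w) |` F)%fset.
    apply/seteqP; split=> t; rewrite SP /mkset in_fset1U.
      move=> [tt [->|tw]]; first by rewrite eqxx.
      by apply/orP; right; apply/FP.
    move=> /orP[/eqP ->|/FP[tt tw]]; split => //.
    - exact/asboolP.
    - by left.
    - by right.
  rewrite cardfsU1; congr (nat_of_bool _ + _)%N.
  apply: contra xw => /FP[_ /infixW/mem_subseq]; apply.
  exact: mem_head.
exists F => //; apply/seteqP; split=> t; rewrite SP /mkset FP; last first.
  by move=> [tt tw]; split=> //; right.
move=> [tt [tE|//]]; exfalso; move/negP: ntrx; apply.
by rewrite -tE; apply/asboolP.
Qed.

Lemma ntranslatesE x y : ntranslates a s x y = occurrences (geod x y).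
Proof.
have [p pE [/andP[_ pU] _]] := geodP x y.
have [F FE Fw] := translatesE pU; rewrite pE -Fw.
by rewrite /ntranslates pE FE set_fsetK.
Qed.

Lemma occurrences_cat A m B :
  (occurrences (A ++ m :: B) <=
     occurrences (rcons A m) + occurrences (m :: B) + minn (size A).+1 k)%N /\
  (occurrences (rcons A m) + occurrences (m :: B) <=
     occurrences (A ++ m :: B) + minn (size A).+1 k)%N.
Proof.
elim: A => [|x A [IH1 IH2]].
  have -> : occurrences (rcons [::] m) = (tr (take k [:: m]) + 0)%N by [].
  have : (0 < k)%N by [].
  rewrite cat0s; move: (occurrences (m :: B)) k (tr (take k [:: m])) => n l [];
  by rewrite /=; lia.
have -> : occurrences ((x :: A) ++ m :: B) =
    (tr (take k (x :: A ++ m :: B)) + occurrences (A ++ m :: B))%N by [].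
have -> : occurrences (rcons (x :: A) m) =
    (tr (take k (x :: rcons A m)) + occurrences (rcons A m))%N by [].
have [kA|Ak] := leqP k (size A).+2.
  have -> : take k (x :: A ++ m :: B) = take k (x :: rcons A m).
    by rewrite -cat_rcons -cat_cons takel_cat //= size_rcons.
  by split; move: IH1 IH2 => /=; lia.
by move: (tr _) (tr _) => [] [] /=; split; move: IH1 IH2 => /=; lia.
Qed.

Lemma tr_act g t : tr (map (a g) t) = tr t.
Proof.
apply: asbool_equiv_eq; split=> [[h _ hE]|[h _ <-]]; last first.
  exists (g * h)%g => //; rewrite -map_comp; apply: eq_map => u /=.
  by rewrite actM.
exists (g^-1 * h)%g => //.
transitivity (map (a g^-1%g) (map (a h) (seg_vertices s))).
  by rewrite -map_comp; apply: eq_map => u /=; rewrite actM.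
rewrite hE -map_comp -[RHS]map_id; apply: eq_map => u /=.
by rewrite -actM mulVg act1.
Qed.

Lemma occurrences_act g w : occurrences (map (a g) w) = occurrences w.
Proof.
elim: w => // x w IH.
rewrite -[RHS]/(tr (take k (x :: w)) + occurrences w)%N -IH.
by rewrite -(tr_act g (take k (x :: w))) map_take.
Qed.

Lemma act_inj g : injective (a g).
Proof.
move=> x y E; rewrite -(act1 a x) -(act1 a y) -(mulVg g) !actM.
by rewrite [act _ g x]E.
Qed.

Lemma geod_act g x y : geod (a g x) (a g y) = map (a g) (geod x y).
Proof.
have [p -> [/andP[pP pU] <-]] := geodP x y.
rewrite -last_map map_cons geodE//; apply/andP; split.
  rewrite /= path_map; move: pP => /=; apply: sub_path => u v /=.
  by rewrite tree_act_adj.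
by rewrite -map_cons map_inj_uniq//; apply: act_inj.
Qed.

Lemma median_cochain_invariant g (x : 'I_2 -> T) :
  median_cochain R a s (a g \o x) = median_cochain R a s x.
Proof.
by rewrite /median_cochain /median_qm /= !ntranslatesE !geod_act !occurrences_act.
Qed.

Let height A m : R :=
  (occurrences (rcons (rev A) m))%:R - (occurrences (m :: A))%:R.

Lemma median_qm_height A m B x y : simple (rev A ++ m :: B) ->
  last m A = x -> last m B = y ->
  `|median_qm R a s x y - (height A m - height B m)| <= 2 * k%:R.
Proof.
move=> AB xE yE.
have BA : simple (rev B ++ m :: A).
  by rewrite -simple_rev rev_cat rev_cons revK cat_rcons.
rewrite /median_qm !ntranslatesE (geod_rev AB)// (geod_rev BA)// /height.
have [c1 c2] := occurrences_cat (rev A) m B.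
have [c3 c4] := occurrences_cat (rev B) m A.
have := geq_minr (size (rev A)).+1 k; have := geq_minr (size (rev B)).+1 k.
move: c1 c2 c3 c4; move: (minn _ _) (minn _ _) => u v c1 c2 c3 c4 uk vk.
have {}c1 := leq_trans c1 (leq_add (leqnn _) vk).
have {}c2 := leq_trans c2 (leq_add (leqnn _) vk).
have {}c3 := leq_trans c3 (leq_add (leqnn _) uk).
have {}c4 := leq_trans c4 (leq_add (leqnn _) uk).
move: c1 c2 c3 c4; rewrite -!(ler_nat R) !natrD => c1 c2 c3 c4.
by rewrite ler_norml; apply/andP; split; lra.
Qed.

Lemma coboundary_median_bounded : bounded_fun (coboundary (median_cochain R a s)).
Proof.
apply/bounded_funE; exists (6 * k%:R) => x.
rewrite /coboundary !big_ord_recl big_ord0 /= /median_cochain /=.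
set x0 := x ord0; set x1 := x (lift ord0 ord0); set x2 := x (lift ord0 (lift ord0 ord0)).
have [m [A [B [C [[Ax By Cz] AB BC AC]]]]] := median_exists x0 x1 x2.
have := median_qm_height AB Ax By.
have := median_qm_height BC By Cz.
have := median_qm_height AC Ax Cz.
rewrite !ler_norml => /andP[? ?] /andP[? ?] /andP[? ?].
have -> : lift ord0 (@ord_max 1) = lift ord0 (lift ord0 ord0) by exact: val_inj.
have -> : lift (lift ord0 ord0) (@ord0 1) = ord0 :> 'I_3 by exact: val_inj.
have -> : lift (lift ord0 ord0) (@ord_max 1) = lift ord0 (lift ord0 ord0) :> 'I_3.
  exact: val_inj.
have -> : lift (lift ord0 (lift ord0 ord0)) (@ord0 1) = ord0 :> 'I_3.
  exact: val_inj.
have -> : lift (lift ord0 (lift ord0 ord0)) (@ord_max 1) = lift ord0 ord0 :> 'I_3.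
  exact: val_inj.
rewrite -/x0 -/x1 -/x2 expr0 /bump /= expr1 sqrrN expr1n.
by apply/andP; split; lra.
Qed.

End MedianTheory.

Definition median_cocycle (R : realType) (Gamma : groupType) (T : tree)
    (a : tree_action Gamma T) (s : segment T) : Zb R a 2 :=
  MkZb (coboundary_bcocycle (@median_cochain_invariant R Gamma T a s)
          (coboundary_median_bounded R a s)).

Definition median_class (R : realType) (Gamma : groupType) (T : tree)
    (a : tree_action Gamma T) (s : segment T) : Hb R a 2 :=
  Hb_class (median_cocycle R a s).

(* Main.v *)
Require Import Defs.
From mathcomp Require Import all_boot all_order all_algebra.
From mathcomp Require Import all_classical reals.
From mathcomp Require Import zify ring lra.

(* For a translate [t] of [s], let [e_t (x, y)] be [1] if [t] occurs in [[x, y]],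
   [-1] if it occurs in [[y, x]] and [0] otherwise, so that [f_s] is the sum of
   the [e_t]. Let [z] be a bounded cocycle of degree [n >= 1]. Inserting the
   first vertex of [t] as the first argument of [z] gives a cochain [z_t] of
   degree [n - 1], whose coboundary is [z]. Hence
   [delta (\sum_t delta e_t \cup z_t) = \sum_t delta e_t \cup z
   = delta f_s \cup z].
   The sum [\sum_t delta e_t \cup z_t] is bounded: for given [x, y, w], only the
   translates passing through the median of [x, y, w] have
   [delta e_t (x, y, w) <> 0], and their number is bounded in terms of the
   length of [s]. *)

Set Implicit Arguments.
Unset Strict Implicit.
Unset Printing Implicit Defensive.

Import Order.TTheory GRing.Theory Num.Theory.

Local Open Scope ring_scope.

Lemma coboundary1 (R : realType) (S : Type) (k : cochain R S 1) (X : nat -> S) :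
  ev (coboundary k) X = ev k (fun i => X i.+1)
    - ev k (fun i => X (bump 1 i)) + ev k (fun i => X (bump 2 i)).
Proof.
rewrite ev_coboundary !big_ord_recl big_ord0 /= expr0 expr1 sqrrN expr1n.
by rewrite !mul1r mulN1r addr0 addrA.
Qed.

(** * Coning off cocycles *)

Section Cone.
Variables (R : realType) (S : Type).

Definition insert0 (p : S) (X : nat -> S) (i : nat) : S :=
  if i is j.+1 then X j else p.

(** Evaluate [coboundary z] on the sequence [p, X 0, X 1, ...]: the face omitting [p] is
    [ev z X]. *)
Lemma cocycle_insert0 n (z : cochain R S n.+1) (p : S) (X : nat -> S) :
  coboundary z = 0 ->
  ev z X = \sum_(j < n.+2) (-1) ^+ j * ev z (insert0 p (X \o bump j)).
Proof.
move=> z0; have := congr1 (fun c => ev c (insert0 p X)) z0.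
rewrite ev_coboundary /= big_ord_recl /= expr0 mul1r [X in _ = X]/ev.
move/eqP; rewrite addr_eq0 -sumrN => /eqP E.
rewrite (_ : ev z X = ev z (insert0 p X \o bump 0))// E.
apply: eq_bigr => j _.
rewrite exprS mulN1r mulNr opprK; congr (_ * _).
by apply: ev_eq => -[|i] _ //=; rewrite bumpS.
Qed.

End Cone.

(** * Weighted sums over the translates occurring in a geodesic *)

Section TranslateSums.
Variables (R : realType) (Gamma : groupType) (T : tree).
Variables (a : tree_action Gamma T) (s : segment T).
Implicit Types (x y u v m : T) (t w A B C : seq T) (h : T -> R).

Let k := size (seg_vertices s).
Let tr t := `[< translates a s t >].

(** Only first vertices are recorded, because [z_t] depends on [t] only through its first vertex. *)
Fixpoint starts_in w : seq T :=
  if w is x :: w' then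
    (if tr (take k w) then [:: x] else [::]) ++ starts_in w'
  else [::].

Definition tsum h w : R := \sum_(x <- starts_in w) h x.

(** This is [\sum_t e_t (x, y) * h t_0], with [t_0] the first vertex of [t]; [tsum_coboundary] has
    [delta e_t] instead. *)
Definition signed_tsum h x y : R := tsum h (geod x y) - tsum h (geod y x).

Definition tsum_coboundary h x y v : R :=
  signed_tsum h y v - signed_tsum h x v + signed_tsum h x y.

Lemma tsum_cons h x w :
  tsum h (x :: w) =
    (if tr (take k (x :: w)) then h x else 0) + tsum h w.
Proof.
rewrite /tsum -[starts_in (x :: w)]/((if _ then _ else _) ++ _) big_cat.
by case: ifP => _; rewrite ?big_seq1 ?big_nil.
Qed.

Lemma tsum_nil h : tsum h [::] = 0.
Proof. exact: big_nil. Qed.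

Lemma tsum_cst c w : tsum (fun=> c) w = (occurrences a s w)%:R * c.
Proof.
elim: w => [|x w IH]; first by rewrite tsum_nil mul0r.
rewrite tsum_cons IH.
have -> : occurrences a s (x :: w) = (tr (take k (x :: w)) + occurrences a s w)%N.
  by [].
by rewrite natrD mulrDl; case: (tr _); rewrite ?mul1r ?mul0r.
Qed.

(** With [c] a value of [z], this writes the cup product as a sum over translates. *)
Lemma tsum_coboundary_cst c x y v : tsum_coboundary (fun=> c) x y v =
  (median_qm R a s y v - median_qm R a s x v + median_qm R a s x y) * c.
Proof.
rewrite /tsum_coboundary /signed_tsum /median_qm !ntranslatesE !tsum_cst.
by ring.
Qed.

Lemma eq_tsum_coboundary h h' x y v : h =1 h' ->
  tsum_coboundary h x y v = tsum_coboundary h' x y v.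
Proof. by move=> /funext ->. Qed.

Lemma tsum_coboundary_sum n (c : nat -> R) (h : nat -> T -> R) x y v :
  \sum_(j < n) c j * tsum_coboundary (h j) x y v =
    tsum_coboundary (fun u => \sum_(j < n) c j * h j u) x y v.
Proof.
have E w : tsum (fun u => \sum_(j < n) c j * h j u) w =
    \sum_(j < n) c j * tsum (h j) w.
  by rewrite /tsum exchange_big /=; apply: eq_bigr => j _; rewrite mulr_sumr.
rewrite /tsum_coboundary /signed_tsum !E -!sumrB -!big_split /=.
by apply: eq_bigr => j _; ring.
Qed.

Lemma starts_in_act g w :
  starts_in (map (a g) w) = map (a g) (starts_in w).
Proof.
elim: w => // x w IH.
rewrite -[LHS]/((if tr (take k (map (a g) (x :: w))) then
  [:: a g x] else [::]) ++ starts_in (map (a g) w)).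
rewrite IH -map_take.
rewrite (_ : tr (map _ _) = tr (take k (x :: w))); last exact: tr_act.
rewrite -[starts_in (x :: w)]/((if _ then _ else _) ++ _) map_cat.
by case: ifP.
Qed.

Lemma tsum_coboundary_act g h x y v :
  tsum_coboundary h (a g x) (a g y) (a g v) =
    tsum_coboundary (h \o a g) x y v.
Proof.
by rewrite /tsum_coboundary /signed_tsum /tsum !geod_act !starts_in_act !big_map.
Qed.

(** * Uniform bound through medians *)

Section Bound.
Variables (h : T -> R) (M : R).
Hypothesis hM : forall x, `|h x| <= M.

(** The factor [minn (size A).+1 k] bounds the number of starting vertices whose window of length
    [k] reaches past [m]; for each, at most two terms of size [M] fail to cancel. *)
Lemma tsum_cat A m B :
  `|tsum h (A ++ m :: B) - (tsum h (rcons A m) + tsum h (m :: B))|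
    <= (minn (size A).+1 k)%:R * (2 * M).
Proof.
have M0 : 0 <= M := le_trans (normr_ge0 _) (hM m).
have term x t : `|if tr t then h x else 0| <= M.
  by case: (tr t); rewrite ?normr0.
elim: A => [|x A IH].
  rewrite cat0s [rcons _ _]/= opprD addrCA subrr addr0 normrN.
  rewrite tsum_cons tsum_nil addr0.
  rewrite (_ : minn _ _ = 1%N); last exact/minn_idPl.
  by rewrite mul1r; move: (term m (take k [:: m])); lra.
rewrite cat_cons rcons_cons 2!tsum_cons.
have [kA|Ak] := leqP k (size A).+2.
  have -> : take k (x :: A ++ m :: B) = take k (x :: rcons A m).
    by rewrite -cat_rcons -cat_cons takel_cat //= size_rcons.
  set c := if _ then _ else _.
  rewrite -[c + _ + tsum h (m :: B)]addrA [c + _]addrC addrKA.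
  by apply: le_trans IH _; rewrite ler_wpM2r ?ler_nat ?mulr_ge0// geq_minr.
move: IH; rewrite (minn_idPl _); last by do 2!apply: ltnW.
move=> IH; rewrite -natr1 mulrDl mul1r.
move: (term x (take k (x :: A ++ m :: B))) (term x (take k (x :: rcons A m))).
move: IH; rewrite !ler_norml => /andP[? ?] /andP[? ?] /andP[? ?].
by apply/andP; split; lra.
Qed.

Let height A m : R := tsum h (rcons (rev A) m) - tsum h (m :: A).

(** Cutting at [m] costs at most [2 * (k%:R * M)] in each of the two directions. *)
Lemma signed_tsum_height A m B x y : simple (rev A ++ m :: B) ->
  last m A = x -> last m B = y ->
  `|signed_tsum h x y - (height A m - height B m)| <= 4 * (k%:R * M).
Proof.
move=> AB xE yE.
have M0 : 0 <= M := le_trans (normr_ge0 _) (hM m).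
have BA : simple (rev B ++ m :: A).
  by rewrite -simple_rev rev_cat rev_cons revK cat_rcons.
rewrite /signed_tsum (geod_rev AB)// (geod_rev BA)// /height.
have cat_bound C D : `|tsum h (C ++ m :: D) - (tsum h (rcons C m) + tsum h (m :: D))|
    <= 2 * (k%:R * M).
  apply: le_trans (tsum_cat C m D) _; rewrite mulrCA ler_wpM2l//.
  by rewrite ler_wpM2r// ler_nat geq_minr.
move: (cat_bound (rev A) B) (cat_bound (rev B) A).
rewrite !ler_norml => /andP[? ?] /andP[? ?].
by apply/andP; split; lra.
Qed.

(** The heights of the three legs at the median cancel, leaving three errors of [4 * (k%:R * M)]. *)
Lemma tsum_coboundary_bound x y v : `|tsum_coboundary h x y v| <= 12 * (k%:R * M).
Proof.
have [m [A [B [C [[Ax By Cz] AB BC AC]]]]] := median_exists x y v.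
have := signed_tsum_height AB Ax By.
have := signed_tsum_height BC By Cz.
have := signed_tsum_height AC Ax Cz.
rewrite /tsum_coboundary !ler_norml => /andP[? ?] /andP[? ?] /andP[? ?].
by apply/andP; split; lra.
Qed.

End Bound.

End TranslateSums.

(** * The bounded primitive of the cup product *)

Section Primitive.
Variables (R : realType) (Gamma : groupType) (T : tree).
Variables (a : tree_action Gamma T) (s : segment T) (n : nat).
Variable z : cochain R T n.+1.

Definition cone (X : nat -> T) (u : T) : R := ev z (insert0 u X).

(** This is [\sum_t delta e_t \cup z_t]; entry 2 is the shared one. *)
Definition primitive : cochain R T n.+2 := fun x =>
  tsum_coboundary a s (cone (fun i => x (inord i.+2)))
    (x (inord 0)) (x (inord 1)) (x (inord 2)).

Lemma eq_cone X Y : (forall i, (i <= n)%N -> X i = Y i) -> cone X =1 cone Y.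
Proof. by move=> XY u; apply: ev_eq => -[|i] //= ni; rewrite XY. Qed.

Lemma ev_primitive X : ev primitive X =
  tsum_coboundary a s (cone (fun i => X i.+2)) (X 0%N) (X 1%N) (X 2%N).
Proof.
rewrite /ev /primitive !inordK//; apply: eq_tsum_coboundary.
by apply: eq_cone => i ni; rewrite inordK.
Qed.

Lemma primitive_bounded : bounded_cochain a n.+1 z ->
  bounded_cochain a n.+2 primitive.
Proof.
move=> [/bounded_funE[M zM] za]; split.
  apply/bounded_funE; eexists => x; apply: tsum_coboundary_bound => u.
  exact: zM.
move=> g x; rewrite /primitive /= tsum_coboundary_act.
apply: eq_tsum_coboundary => u; rewrite /cone /ev /= -[RHS](za g).
by congr (z _); apply/funext => -[[|i] /= _].
Qed.

Lemma coboundary_primitive : coboundary z = 0 ->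
  coboundary primitive = cup_cochain (coboundary (median_cochain R a s)) z.
Proof.
move=> z0; apply: ev_inj => X.
rewrite (@ev_cup _ _ 2 n.+1) coboundary1.
rewrite -[RHS](@tsum_coboundary_cst _ _ _ a s _ (X 0%N) (X 1%N) (X 2%N)).
pose Y i := X i.+2.
(* The constant weight is expanded with a different cone point [u] for each translate, namely its
   first vertex. *)
rewrite (eq_tsum_coboundary a s _ _ _
  (fun u => cocycle_insert0 u (fun i => X (2 + i)%N) z0)).
rewrite -(tsum_coboundary_sum a s n.+2 (fun j => (-1) ^+ j)
  (fun j => cone (Y \o bump j))).
(* Faces 0, 1, 2 carry the same cone, so [delta (delta e_t) = 0] reduces them to the term [j = 0] on
   the right. Later faces match one by one, with indices shifted by 2 and hence equal signs. *)
rewrite ev_coboundary 3!big_ord_recl [in RHS]big_ord_recl !addrA.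
congr (_ + _).
  rewrite !ev_primitive /= expr0 expr1 sqrrN expr1n !mul1r mulN1r.
  by rewrite /tsum_coboundary /=; ring.
apply: eq_bigr => j _; rewrite ev_primitive.
rewrite /= !exprS !mulN1r !opprK; congr (_ * _).
apply: eq_tsum_coboundary; apply: eq_cone => i _.
by rewrite /Y /=; congr (X _); rewrite /bump; lia.
Qed.

End Primitive.

Theorem theorem1p4 (R : realType) (Gamma : groupType) (T : tree)
    (a : tree_action Gamma T) (s : segment T) (n : nat) (n_ge1 : (1 <= n)%N)
    (zeta : Hb R a n) :
  cup (median_class R a s) zeta = 0.
Proof.
case: n n_ge1 zeta => // n _ zeta.
have -> : zeta = Hb_class (repr (zeta : {ideal_quot Bb R a n.+1})).
  by rewrite /Hb_class reprK.
move: (repr _) => z; have /bcocycleP[zb z0] := Zb_valP z.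
rewrite /median_class cup_class; apply/Hb_class_eq0.
exists (primitive a s z); first exact: primitive_bounded.
exact: coboundary_primitive.
Qed.
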